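(* Let $\mathbf{A},\mathbf{B}$ be symmetric $n\times n$ real matrices, and assume that $\mathbf{B}$ is positive definite and strictly diagonally dominant. Let $\lambda$ be a complementarity eigenvalue of $(\mathbf{A},\mathbf{B})$. Then $$\min\left\{\min_{i\in[n]}\frac{a_i^-}{b_i^-},\ \min_{i\in[n]}\frac{a_i^-}{b_i^+}\right\}\le\lambda\le\max\left\{\max_{i\in[n]}\frac{a_i^+}{b_i^-},\ \max_{i\in[n]}\frac{a_i^+}{b_i^+}\right\}.$$
   Context: $[n]=\{1,\dots,n\}$; vector inequalities are componentwise. A real number $\lambda$ is a complementarity eigenvalue of $(\mathbf{A},\mathbf{B})$ if there is $\mathbf{x}\in\mathbb{R}^n$ with $(\mathbf{A}-\lambda\mathbf{B})\mathbf{x}\ge\mathbf{0}$, $\mathbf{x}\ge\mathbf{0}$, $\mathbf{x}^\top(\mathbf{A}-\lambda\mathbf{B})\mathbf{x}=0$ and $\sum_{i=1}^n x_i=1$. A matrix $\mathbf{M}=(m_{ij})$ is strictly diagonally dominant if $|m_{ii}|>\sum_{j\ne i}|m_{ij}|$ for every $i\in[n]$. For $\mathbf{M}\in\mathbb{R}^{n\times n}$ and $i\in[n]$, set $$r_i^+(\mathbf{M}):=\sum_{j\ne i}\max\{m_{ij},0\},\quad r_i^-(\mathbf{M}):=-\sum_{j\ne i}\min\{m_{ij},0\},$$ $$m_i^+:=m_{ii}+r_i^+(\mathbf{M}),\quad m_i^-:=m_{ii}-r_i^-(\mathbf{M}).$$ Thus $a_i^\pm$ and $b_i^\pm$ denote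 these quantities for $\mathbf{A}=(a_{ij})$ and $\mathbf{B}=(b_{ij})$ respectively. *)

(* Defs.v *)
From mathcomp Require Export all_boot all_order all_algebra.
From mathcomp Require Export reals.

Set Implicit Arguments.
Unset Strict Implicit.
Unset Printing Implicit Defensive.

Import Order.TTheory GRing.Theory Num.Theory.
Local Open Scope ring_scope.

Section Defs.
Variables (R : realFieldType) (n : nat).
Implicit Types (A B M : 'M[R]_n) (x : 'cV[R]_n) (lambda : R) (i : 'I_n).

Definition positive_definite M : Prop :=
  forall x, x != 0 -> 0 < (x^T *m M *m x) 0 0.

Definition strictly_diagonally_dominant M : Prop :=
  forall i, \sum_(j < n | j != i) `|M i j| < `|M i i|.

Definition complementarity_eigenvalue A B lambda : Prop :=
  exists x : 'cV[R]_n,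
    [/\ forall i, 0 <= ((A - lambda *: B) *m x) i 0,
        forall i, 0 <= x i 0,
        (x^T *m (A - lambda *: B) *m x) 0 0 = 0
      & \sum_(i < n) x i 0 = 1].

Definition rplus M i : R := \sum_(j < n | j != i) Num.max (M i j) 0.
Definition rminus M i : R := - \sum_(j < n | j != i) Num.min (M i j) 0.

Definition mplus M i : R := M i i + rplus M i.
Definition mminus M i : R := M i i - rminus M i.

End Defs.

(* Extrema of a family over the nonempty index set 'I_n.+1: the initial value
   f ord0 is itself a member of the family, so it adds nothing. *)
Definition min_ord (R : realFieldType) (n : nat) (f : 'I_n.+1 -> R) : R :=
  \big[Num.min/f ord0]_(i < n.+1) f i.

Definition max_ord (R : realFieldType) (n : nat) (f : 'I_n.+1 -> R) : R :=
  \big[Num.max/f ord0]_(i < n.+1) f i.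

(* Main.v *)
(* At an index [i] where the eigenvector [x] is largest, [x i > 0], so
   complementarity gives [(A x)_i = lambda (B x)_i].  Since [0 <= x j <= x i],
   [(A x)_i] lies between [a_i^- x_i] and [a_i^+ x_i], and [(B x)_i] between
   [b_i^- x_i] and [b_i^+ x_i], where [b_i^- > 0].  The sign of [a_i^+]
   (resp. [a_i^-]) decides which of the two quotients bounds [lambda]. *)
Require Import Defs.
Import Order.TTheory GRing.Theory Num.Theory.
Local Open Scope ring_scope.

Set Implicit Arguments.
Unset Strict Implicit.
Unset Printing Implicit Defensive.

Section RowBounds.
Variables (R : realFieldType) (n : nat).
Implicit Types (M : 'M[R]_n) (x : 'cV[R]_n) (i : 'I_n).

(** The diagonal terms agree. For [j != i], multiplying [x j 0 <= x i 0] by [Num.min (M i j) 0],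
    which is nonpositive, reverses it, and [Num.min (M i j) 0 <= M i j] finishes the lower bound;
    the upper one is dual. *)
Lemma mulmx_row_bounds M x i :
    (forall j, 0 <= x j 0) -> (forall j, x j 0 <= x i 0) ->
  mminus M i * x i 0 <= (M *m x) i 0 <= mplus M i * x i 0.
Proof.
move=> x0 xi; rewrite /mminus /mplus /rminus /rplus opprK !mulrDl !mulr_suml.
rewrite mxE [\sum_(j < n) M i j * x j 0](bigD1 i) //= !lerD2l.
apply/andP; split; apply: ler_sum => j _.
- apply: (@le_trans _ _ (Num.min (M i j) 0 * x j 0)).
    by rewrite ler_wnM2l // ge_min lexx orbT.
  by rewrite ler_wpM2r // ge_min lexx.
- apply: (@le_trans _ _ (Num.max (M i j) 0 * x j 0)).
    by rewrite ler_wpM2r // le_max lexx.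
  by rewrite ler_wpM2l // le_max lexx orbT.
Qed.

Lemma positive_definite_diag_gt0 M i : positive_definite M -> 0 < M i i.
Proof.
move=> /(_ (delta_mx i 0)); rewrite trmx_delta -rowE -colE !mxE; apply.
by apply/eqP => /matrixP /(_ i 0) /eqP; rewrite !mxE !eqxx oner_eq0.
Qed.

(** Positive definiteness makes the diagonal entry positive, so dominance bounds it without absolute
    value; each [- Num.min (M i j) 0] is at most the norm of [M i j]. *)
Lemma mminus_gt0 M i :
  positive_definite M -> strictly_diagonally_dominant M -> 0 < mminus M i.
Proof.
move=> pdM /(_ i); rewrite gtr0_norm ?positive_definite_diag_gt0 // => sdd.
rewrite /mminus subr_gt0; apply: le_lt_trans sdd.
rewrite /rminus -sumrN; apply: ler_sum => j _.
by rewrite lerNl le_min lerNl oppr_le0 normr_ge0 andbT -normrN ler_norm.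
Qed.

(** The quadratic form is a sum of nonnegative products of [x j 0] and [(M *m x) j 0], so each
    product vanishes. *)
Lemma complementarity_mulmx M x i :
    (forall j, 0 <= (M *m x) j 0) -> (forall j, 0 <= x j 0) ->
    (x^T *m M *m x) 0 0 = 0 ->
  0 < x i 0 -> (M *m x) i 0 = 0.
Proof.
move=> Mx0 x0; rewrite -mulmxA mxE => /eqP.
rewrite psumr_eq0; last by move=> j _; rewrite mxE mulr_ge0.
by move=> /allP /(_ i (mem_index_enum _)); rewrite mxE mulf_eq0 => /orP[] /eqP ->;
  rewrite ?ltxx.
Qed.

End RowBounds.

Lemma exists_max_entry_gt0 (R : realFieldType) n (x : 'cV[R]_n.+1) :
    (forall i, 0 <= x i 0) -> \sum_(i < n.+1) x i 0 = 1 ->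
  exists2 i, 0 < x i 0 & forall j, x j 0 <= x i 0.
Proof.
move=> x0 sumx; case: (@arg_maxP _ _ _ ord0 predT (x^~ 0)) => // i _ imax.
exists i => [|j]; last exact: imax.
rewrite lt_def x0 andbT; apply/eqP => xi0.
have/eqP := sumx; rewrite big1 ?(eq_sym 0) ?oner_eq0 // => j _.
by apply/eqP; rewrite eq_le x0 andbT -xi0; exact: imax.
Qed.

(** Here [l <= a / b], and on positive denominators the quotient is largest at [b1] if [0 <= a] and
    at [b2] if [a < 0]. *)
Lemma le_max_div (R : realFieldType) (a b b1 b2 l : R) :
  0 < b1 -> b1 <= b <= b2 -> l * b <= a -> l <= Num.max (a / b1) (a / b2).
Proof.
move=> b10 /andP[b1b bb2]; have b0 := lt_le_trans b10 b1b.
have b20 := lt_le_trans b0 bb2.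
rewrite -ler_pdivlMr // => /le_trans; apply; rewrite le_max.
have [a0|/ltW a0] := leP 0 a.
- by rewrite ler_wpM2l // lef_pV2.
- by rewrite orbC ler_wnM2l // lef_pV2.
Qed.

Lemma ge_min_div (R : realFieldType) (a b b1 b2 l : R) :
  0 < b1 -> b1 <= b <= b2 -> a <= l * b -> Num.min (a / b1) (a / b2) <= l.
Proof.
(* Apply the upper bound to [- a] and [- l]. *)
move=> b10 b12; rewrite -lerN2 -mulNr => /(le_max_div b10 b12).
by rewrite !mulNr -oppr_min lerN2.
Qed.

Theorem corollary4p1 (R : realType) (n : nat) (A B : 'M[R]_n.+1) (lambda : R)
    (symA : A \is symmetricmx) (symB : B \is symmetricmx)
    (pdB : positive_definite B)
    (sddB : strictly_diagonally_dominant B)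
    (eig : complementarity_eigenvalue A B lambda) :
  Num.min (min_ord (fun i => mminus A i / mminus B i))
          (min_ord (fun i => mminus A i / mplus B i)) <= lambda
  /\ lambda <= Num.max (max_ord (fun i => mplus A i / mminus B i))
                       (max_ord (fun i => mplus A i / mplus B i)).
Proof.
case: eig => x [Mx0 x0 xMx sumx].
have [i xi0 imax] := exists_max_entry_gt0 x0 sumx.
have := complementarity_mulmx Mx0 x0 xMx xi0.
rewrite mulmxBl -scalemxAl mxE [X in _ + X]mxE [X in - X]mxE => /eqP.
rewrite subr_eq0 => /eqP AB.
have /andP[Al Au] := mulmx_row_bounds A x0 imax.
have Bb := mulmx_row_bounds B x0 imax.
(* Dividing by [x i 0] gives the denominator [b] of the quotient lemmas; [AB] turns [lambda * b]
   into [(A *m x) i 0 / x i 0]. *)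
have bb : mminus B i <= (B *m x) i 0 / x i 0 <= mplus B i.
  by rewrite ler_pdivlMr // ler_pdivrMr.
have b0 := mminus_gt0 i pdB sddB.
split.
- apply: (@le_trans _ _ (Num.min (mminus A i / mminus B i) (mminus A i / mplus B i))).
    by rewrite le_min !ge_min !bigmin_le ?orbT.
  by apply: ge_min_div b0 bb _; rewrite mulrA -AB ler_pdivlMr.
- apply: (@le_trans _ _ (Num.max (mplus A i / mminus B i) (mplus A i / mplus B i))).
    by apply: le_max_div b0 bb _; rewrite mulrA -AB ler_pdivrMr.
  by rewrite ge_max !le_max !le_bigmax ?orbT.
Qed.
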